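(* Let $[\,\cdot\,]_0$ denote the constant term of a Laurent polynomial in $x,y$. The following sequences $(a_n)_{n\ge0}$ (defined in the context) admit Laurent polynomial representations $a_n=[F^n]_0$ for all $n\ge 0$, with the indicated $F$: (1) $\mathbb{T}(3)$: $\displaystyle F=\frac{(y+2+x)(y-2x-1)(x-2y-1)}{xy}$. (2) $\mathbb{T}(2)$: $\displaystyle F=\frac{3x^2y^2+x^2+3xy^2+2x+1}{xy}$. (3) $\mathbb{O}(4)$: $\displaystyle F=\frac{x^2y^2+2x^2y-3x^2+2xy^2+12xy+2x-3y^2+2y+1}{xy}$. (4) $\mathbb{O}(3)$: two non-equivalent Laurent polynomials, each representing the sequence: $$F^{(1)}=\frac{(x+y-1)(2x^2-4xy+x+2y^2+y-1)}{xy},\qquad F^{(2)}=\frac{(y+2x+1)(xy+x+2y)}{xy}.$$ (5) $\mathbb{I}(5)$: $\displaystyle F=\frac{2x^2y^2+3x^2y-2x^2-xy^2+10xy-3x+y+2}{xy}$.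
   Context: Let $\theta=t\frac{d}{dt}$. Each sequence $(a_n)$ is the coefficient sequence of the unique power series solution $\sum_{n\ge0}a_nt^n$ with $a_0=1$ of the differential operator with the same name: $\mathbb{T}(3)$: $2\theta^2-3t(27\theta^2+27\theta+8)+3^6t^2(\theta+\frac23)(\theta+\frac43)$; sequence $1,12,198,3720,75690,1626912,\dots$ $\mathbb{T}(2)$: $\theta^2-3^4t^2(\theta+\frac23)(\theta+\frac43)$; sequence $1,0,18,0,810,0,45360,\dots$ $\mathbb{O}(4)$: $3\theta^2-4t(28\theta^2+28\theta+9)+2^{10}t^2(\theta+\frac34)(\theta+\frac54)$; sequence $1,12,180,2928,49860,\dots$ $\mathbb{O}(3)$: $\theta^2-2t(10\theta^2+10\theta+3)+2^6t^2(\theta+\frac34)(\theta+\frac54)$; sequence $1,6,54,588,7110,\dots$ $\mathbb{I}(5)$: $2\theta^2-t(59\theta^2+59\theta+20)+2^43^3t^2(\theta+\frac56)(\theta+\frac76)$; sequence $1,10,120,1540,20500,\dots$ (An operator $P_0(\theta)+tP_1(\theta)+t^2P_2(\theta)$ corresponds to the recursion $P_0(n+1)a_{n+1}+P_1(n)a_n+P_2(n-1)a_{n-1}=0$ for $n\ge0$, with $a_{-1}=0$.) Two Laurent polynomials are called non-equivalent here if their Newton polygons are not related by an affine unimodular transformation of the lattice $\mathbb{Z}^2$. *)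

(* Defs.v *)
From mathcomp Require Import all_boot all_order all_algebra.
From mathcomp Require Import fraction boolp classical_sets reals.

Set Implicit Arguments.
Unset Strict Implicit.
Unset Printing Implicit Defensive.

Import Order.TTheory GRing.Theory Num.Theory.
Local Open Scope ring_scope.

(* A formal power series in t is identified with its coefficient sequence. *)
Definition tmul (a : nat -> rat) : nat -> rat :=
  fun n => if n is m.+1 then a m else 0.

Definition ddt (a : nat -> rat) : nat -> rat := fun n => n.+1%:R * a n.+1.

Definition theta (a : nat -> rat) : nat -> rat := tmul (ddt a).

Definition theta_poly (P : {poly rat}) (a : nat -> rat) : nat -> rat :=
  fun n => \sum_(i < size P) P`_i * iter i theta a n.

(* The list [:: P_0; P_1; ..; P_r] stands for the differential operator
   P_0(theta) + t P_1(theta) + .. + t^r P_r(theta): powers of t stand on the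
   left, so they are applied after theta. *)
Definition diffop (L : seq {poly rat}) (a : nat -> rat) : nat -> rat :=
  fun n => \sum_(i < size L) iter i tmul (theta_poly L`_i a) n.

Definition is_coef_seq (L : seq {poly rat}) (a : nat -> rat) : Prop :=
  unique (fun b : nat -> rat => b 0%N = 1 /\ forall n, diffop L b n = 0) a.

Section Operators.

Local Notation th := ('X : {poly rat}).

Definition T3 : seq {poly rat} :=
  [:: 2 * th ^+ 2;
      - (3 * (27 * th ^+ 2 + 27 * th + 8));
      3 ^+ 6 * (th + (2 / 3)%:P) * (th + (4 / 3)%:P)].

Definition T2 : seq {poly rat} :=
  [:: th ^+ 2;
      0;
      - (3 ^+ 4 * (th + (2 / 3)%:P) * (th + (4 / 3)%:P))].

Definition O4 : seq {poly rat} :=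
  [:: 3 * th ^+ 2;
      - (4 * (28 * th ^+ 2 + 28 * th + 9));
      2 ^+ 10 * (th + (3 / 4)%:P) * (th + (5 / 4)%:P)].

Definition O3 : seq {poly rat} :=
  [:: th ^+ 2;
      - (2 * (10 * th ^+ 2 + 10 * th + 3));
      2 ^+ 6 * (th + (3 / 4)%:P) * (th + (5 / 4)%:P)].

Definition I5 : seq {poly rat} :=
  [:: 2 * th ^+ 2;
      - (59 * th ^+ 2 + 59 * th + 20);
      2 ^+ 4 * 3 ^+ 3 * (th + (5 / 6)%:P) * (th + (7 / 6)%:P)].

End Operators.

(* Laurent polynomials in x, y are the elements p / (x y)^k, with p in Q[x,y],
   of the field Q(x,y).  In {poly {poly rat}} the outer variable is x, the
   inner one is y, so that p`_i`_j is the coefficient of x^i y^j in p. *)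
Local Notation "p %:F" := (FracField.tofrac p).

Definition ratfun := {fraction {poly {poly rat}}}.

Definition x : ratfun := 'X%:F.
Definition y : ratfun := ('X%:P)%:F.

Local Open Scope classical_set_scope.

(* The coefficient of x^(m 0 0) y^(m 0 1) in the Laurent polynomial f; see
   laurent_coefE.  The value is 0 if f is not a Laurent polynomial. *)
Definition laurent_coef (f : ratfun) (m : 'rV[int]_2) : rat :=
  xget 0 [set c | exists (p : {poly {poly rat}}) (k i j : nat),
    [/\ f = p%:F / (x * y) ^+ k, m 0 0 = i%:Z - k%:Z, m 0 1 = j%:Z - k%:Z &
        c = p`_i`_j]].

Definition constant_term (f : ratfun) : rat := laurent_coef f 0.

(* The convex hull in R^2 of the exponents of the monomials of f. *)
Definition newton_polygon (R : realType) (f : ratfun) : set 'rV[R]_2 :=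
  [set v | exists (s : seq 'rV[int]_2) (w : 'rV[int]_2 -> R),
    [/\ forall m, m \in s -> laurent_coef f m != 0,
        forall m, m \in s -> 0 <= w m,
        \sum_(m <- s) w m = 1 &
        v = \sum_(m <- s) w m *: map_mx intr m]].

Arguments newton_polygon : clear implicits.

(* Affine unimodular maps act on row vectors, v |-> v A + b. *)
Definition newton_equivalent (R : realType) (f g : ratfun) : Prop :=
  exists (A : 'M[int]_2) (b : 'rV[int]_2),
    A \in unitmx /\
    [set v *m map_mx intr A + map_mx intr b | v in newton_polygon R f]
      = newton_polygon R g.

Lemma theta_polyE (P : {poly rat}) (a : nat -> rat) (n : nat) :
  theta_poly P a n = P.[n%:R] * a n.
Proof.
rewrite /theta_poly horner_coef mulr_suml; apply: eq_bigr => i _.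
rewrite -mulrA; congr (_ * _); elim: (i : nat) => [|k IH] /=.
  by rewrite expr0 mul1r.
rewrite exprS -mulrA -IH /theta /tmul /ddt.
by case: n {IH} => [|n] //; rewrite mul0r.
Qed.

Lemma coef_mulXY (p : {poly {poly rat}}) (l i j : nat) :
  (p * ('X * 'X%:P) ^+ l)`_(i + l)`_(j + l) = p`_i`_j.
Proof.
by rewrite exprMn_comm ?mulrA; [|exact: mulrC];
   rewrite mulrAC coefMXn ltnNge leq_addl /= addnK -polyC_exp
   coefMC coefMXn ltnNge leq_addl /= addnK.
Qed.

Lemma laurent_coefE (p : {poly {poly rat}}) (k i j : nat) (m : 'rV[int]_2) :
    m 0 0 = i%:Z - k%:Z -> m 0 1 = j%:Z - k%:Z ->
  laurent_coef (p%:F / (x * y) ^+ k) m = p`_i`_j.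
Proof.
move=> m0 m1; rewrite /laurent_coef; case: xgetP => [c _|]; last first.
  by move=> /(_ p`_i`_j) []; exists p, k, i, j.
case=> q [l [i' [j' [eqpq m0' m1' ->]]]].
have xyE : x * y = ('X * 'X%:P)%:F by rewrite rmorphM.
have xyN0 : x * y != 0.
  by rewrite xyE tofrac_eq0 mulf_neq0 ?polyX_eq0 ?polyC_eq0 ?polyX_eq0.
have {eqpq} E : p * ('X * 'X%:P) ^+ l = q * ('X * 'X%:P) ^+ k.
  apply/eqP; rewrite -tofrac_eq !rmorphM !rmorphXn /= -xyE.
  by rewrite -eqr_div ?expf_neq0 // eqpq.
have Ei : (i + l = i' + k)%N.
  apply/eqP; rewrite -eqz_nat !PoszD -subr_eq -addrA [l%:Z - _]addrC addrA.
  by rewrite -m0 m0' subrK.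
have Ej : (j + l = j' + k)%N.
  apply/eqP; rewrite -eqz_nat !PoszD -subr_eq -addrA [l%:Z - _]addrC addrA.
  by rewrite -m1 m1' subrK.
by rewrite -(coef_mulXY q k) -E -Ei -Ej coef_mulXY.
Qed.

(* Main.v *)
(* Write F = P / (x y), so that [F^n]_0 is the coefficient of (x y)^n in P^n.
   A Laurent polynomial of the form x dG/dx or y dG/dy has constant term 0, so
   an order two recursion c0 a_(n+2) + c1 a_(n+1) + c2 a_n = 0 holds as soon as
     d (c0 F^2 + c1 F + c2) F^n
       = x d/dx (A F^n / (x y)^2) + y d/dy (B F^n / (x y)^2)
   for some polynomials A, B and a constant d <> 0.  After multiplication by F
   this is an identity of polynomials in x, y and n.  The certificates A, B
   (of degree 1 in n) solve a linear system; when P is symmetric, B can be taken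
   to be A with x and y exchanged.

   The Newton polygon of F1 has an edge of lattice length 3, while that of F2
   lies in the square [-1, 1]^2, which contains no such segment. *)
Require Import Defs.
From mathcomp Require Import all_boot all_order all_algebra.
From mathcomp Require Import fraction boolp classical_sets reals.
From mathcomp Require Import ring zify.

Import Order.TTheory GRing.Theory Num.Theory.
Local Open Scope ring_scope.

Local Notation bp := {poly {poly rat}}.

(** * Bivariate polynomials given by integer coefficient matrices *)

Definition bipoly {R : comNzRingType} (u v : R) (M : seq (seq int)) : R :=
  foldr (fun r p => foldr (fun c q => c%:~R + v * q) 0 r + u * p) 0 M.

Definition bentry (M : seq (seq int)) (i j : nat) : int :=
  nth 0 (nth [::] M i) j.

Definition Pxy (M : seq (seq int)) : bp := bipoly 'X ('X%:P) M.

Lemma rmorph_bipoly (R S : comNzRingType) (f : {rmorphism R -> S}) (u v : R) M :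
  f (bipoly u v M) = bipoly (f u) (f v) M.
Proof.
elim: M => [|r M IH]; rewrite /= ?rmorph0 // rmorphD rmorphM IH; congr (_ + _).
by elim: r {IH} => [|c r IH]; rewrite /= ?rmorph0 // rmorphD rmorphM IH rmorph_int.
Qed.

Lemma coef_Pxy M i j : (Pxy M)`_i`_j = (bentry M i j)%:~R.
Proof.
rewrite /Pxy /bentry; elim: M i => [|r M IH] i /=.
  by rewrite coef0 coef0 nth_nil nth_nil.
(* A row involves only y, so it is a constant in the outer variable and its coefficients are read
   off in the inner ring. *)
have rowE : foldr (fun c q => c%:~R + 'X%:P * q) 0 r =
    (foldr (fun (c : int) (q : {poly rat}) => c%:~R + 'X * q) 0 r)%:P.
  elim: r => [|c r IHr] /=; first by rewrite polyC0.
  by rewrite IHr polyCD polyCM rmorph_int.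
rewrite rowE coefD coefC coefXM; case: i => [|i] /=; last by rewrite add0r IH.
rewrite addr0; elim: r j {rowE IH} => [|c r IHr] j /=.
  by rewrite coef0 nth_nil.
rewrite coefD -(rmorph_int (@polyC rat)) coefC coefXM.
by case: j => [|j] /=; rewrite ?addr0 // add0r IHr.
Qed.

(** * The Euler operators x d/dx and y d/dy *)

Definition eulerx (p : bp) : bp := 'X * p^`().
Definition eulery (p : bp) : bp := swapXY (eulerx (swapXY p)).

Lemma coef_eulerx p i j : (eulerx p)`_i`_j = i%:R * p`_i`_j.
Proof.
rewrite /eulerx coefXM; case: i => [|i] /=; first by rewrite coef0 mul0r.
by rewrite coef_deriv coefMn mulr_natl.
Qed.

Lemma coef_eulery p i j : (eulery p)`_i`_j = j%:R * p`_i`_j.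
Proof. by rewrite /eulery coef_swapXY coef_eulerx coef_swapXY. Qed.

Lemma bpP (p q : bp) : (forall i j, p`_i`_j = q`_i`_j) -> p = q.
Proof. by move=> pq; apply/polyP => i; apply/polyP => j. Qed.

Lemma eulerxM p q : eulerx (p * q) = eulerx p * q + p * eulerx q.
Proof. by rewrite /eulerx derivM; ring. Qed.

(** The extra factor [p] avoids the exponent n - 1, so that n = 0 needs no separate form. *)
Lemma eulerxX p n : p * eulerx (p ^+ n) = n%:R * (eulerx p * p ^+ n).
Proof.
rewrite /eulerx deriv_exp -mulr_natl; case: n => [|n].
  by rewrite !mul0r !mulr0.
by rewrite /= exprS; ring.
Qed.

Lemma swapXYM (p q : bp) : swapXY (p * q) = swapXY p * swapXY q.
Proof. exact: rmorphM. Qed.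

Lemma euleryM p q : eulery (p * q) = eulery p * q + p * eulery q.
Proof.
have addXY r s : swapXY (r + s) = swapXY r + swapXY s :> bp by exact: raddfD.
apply: (can_inj swapXYK).
rewrite /eulery addXY [swapXY (p * q)]swapXYM swapXYK eulerxM.
by rewrite [swapXY (_ * q)]swapXYM [swapXY (p * _)]swapXYM !swapXYK.
Qed.

Lemma euleryX p n : p * eulery (p ^+ n) = n%:R * (eulery p * p ^+ n).
Proof.
have expXY q k : swapXY (q ^+ k) = (swapXY q : bp) ^+ k by exact: rmorphXn.
apply: (can_inj swapXYK).
rewrite /eulery [swapXY (p * _)]swapXYM swapXYK expXY eulerxX.
rewrite [in RHS]swapXYM [swapXY (_ * p ^+ n)]swapXYM swapXYK expXY.
by congr (_ * _); symmetry; apply: rmorph_nat.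
Qed.

(** [scale_rows] and [scale_cols] are the Euler operators on matrices: differentiation becomes
    computation on explicit entries, and certificates turn into ring identities. *)
Definition scale_rows (M : seq (seq int)) :=
  mkseq (fun i => [seq i%:Z * c | c <- nth [::] M i]) (size M).
Definition scale_cols (M : seq (seq int)) :=
  [seq mkseq (fun j => j%:Z * nth 0 r j) (size r) | r <- M].

Lemma eulerx_Pxy M : eulerx (Pxy M) = Pxy (scale_rows M).
Proof.
apply: bpP => i j; rewrite coef_eulerx !coef_Pxy /bentry /scale_rows.
case: (ltnP i (size M)) => iM; last first.
  by rewrite !(nth_default [::]) ?size_mkseq // !nth_nil mulr0.
rewrite nth_mkseq //; case: (ltnP j (size (nth [::] M i))) => jM.
  by rewrite (nth_map 0) // rmorphM.
by rewrite !(nth_default 0) ?size_map // mulr0.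
Qed.

Lemma eulery_Pxy M : eulery (Pxy M) = Pxy (scale_cols M).
Proof.
apply: bpP => i j; rewrite coef_eulery !coef_Pxy /bentry /scale_cols.
case: (ltnP i (size M)) => iM; last first.
  by rewrite !(nth_default [::]) ?size_map // !nth_nil mulr0.
rewrite (nth_map [::]) //; case: (ltnP j (size (nth [::] M i))) => jM.
  by rewrite nth_mkseq // rmorphM.
by rewrite !(nth_default 0) ?size_mkseq // mulr0.
Qed.

(** * Constant terms of powers and creative telescoping *)

Local Notation XY := ('X * 'X%:P : bp).

Definition diag_coef (p : bp) (n : nat) : rat := (p ^+ n)`_n`_n.

Lemma constant_term_pow (p : bp) (n : nat) :
  constant_term ((FracField.tofrac p / (x * y)) ^+ n) = diag_coef p n.
Proof.
rewrite exprMn exprVn -rmorphXn /constant_term /diag_coef.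
by apply: laurent_coefE; rewrite mxE subrr.
Qed.

(** The terms with [m.+2] come from differentiating the denominator of A F^m / (xy)^2 = A p^m /
    (xy)^(m+2). The hypothesis carries one more factor [p], so that the derivative of p^m
    contributes [m%:R * A * eulerx p]. *)
Lemma diag_coef_telescope (p : bp) (A B : bp) (m : nat) (d c0 c1 c2 : int) :
  p != 0 -> d != 0 ->
  d%:~R * (c0%:~R * p ^+ 2 + c1%:~R * XY * p + c2%:~R * XY ^+ 2) * p =
    (eulerx A - m.+2%:R * A) * p + m%:R * A * eulerx p
    + ((eulery B - m.+2%:R * B) * p + m%:R * B * eulery p) ->
  c0%:~R * diag_coef p m.+2 + c1%:~R * diag_coef p m.+1
    + c2%:~R * diag_coef p m = 0.
Proof.
move=> p0 d0 H.
have {}H : d%:~R * (c0%:~R * p ^+ m.+2 + c1%:~R * (p ^+ m.+1 * XY ^+ 1)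
      + c2%:~R * (p ^+ m * XY ^+ 2))
    = (eulerx (A * p ^+ m) - m.+2%:R * (A * p ^+ m))
      + (eulery (B * p ^+ m) - m.+2%:R * (B * p ^+ m)).
  apply: (mulIf p0); rewrite eulerxM euleryM.
  have Ex := eulerxX p m; have Ey := euleryX p m.
  transitivity (p ^+ m * (d%:~R *
      (c0%:~R * p ^+ 2 + c1%:~R * XY * p + c2%:~R * XY ^+ 2) * p)).
    by rewrite !exprS; ring.
  rewrite H.
  transitivity (p ^+ m * ((eulerx A - m.+2%:R * A + (eulery B - m.+2%:R * B)) * p)
     + A * (m%:R * (eulerx p * p ^+ m)) + B * (m%:R * (eulery p * p ^+ m))).
    by ring.
  by rewrite -Ex -Ey; ring.
have intC (c : int) : c%:~R = (c%:~R : rat)%:P%:P :> bp by rewrite !rmorph_int.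
have natC (n : nat) : n%:R = (n%:R : rat)%:P%:P :> bp by rewrite !rmorph_nat.
have := congr1 (fun q : bp => q`_(m.+2)`_(m.+2)) H.
(* At x^(m+2) y^(m+2) each Euler operator multiplies by m + 2, which cancels the subtracted term, so
   the right-hand side vanishes. *)
rewrite !intC natC !(coefD, coefN, coefCM) coef_eulerx coef_eulery !subrr.
have := coef_mulXY (p ^+ m.+1) 1 m.+1 m.+1; rewrite addn1 => ->.
have := coef_mulXY (p ^+ m) 2 m m; rewrite addn2 => ->.
by move/eqP; rewrite mulf_eq0 intr_eq0 (negPf d0) /= => /eqP.
Qed.

(** * Recursions of order two and uniqueness of their solutions *)

Lemma diffop_order2E (P0 P1 P2 : {poly rat}) (a : nat -> rat) :
  [/\ diffop [:: P0; P1; P2] a 0 = P0.[0] * a 0%N,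
      diffop [:: P0; P1; P2] a 1 = P0.[1] * a 1%N + P1.[0] * a 0%N &
      forall n, diffop [:: P0; P1; P2] a n.+2 =
        P0.[n.+2%:R] * a n.+2 + P1.[n.+1%:R] * a n.+1 + P2.[n%:R] * a n].
Proof.
by split=> [||n]; rewrite /diffop !big_ord_recl big_ord0 /= !theta_polyE
  ?addr0 ?addrA.
Qed.

(** Since [P0] vanishes at 0, the equation in degree 0 leaves the first term free. At positive
    integers [P0] does not vanish, so each later term is determined by its predecessors. *)
Lemma is_coef_seq_order2 (P0 P1 P2 : {poly rat}) (a : nat -> rat) :
  P0.[0] = 0 -> (forall n : nat, P0.[n.+1%:R] != 0) -> a 0%N = 1 ->
  P0.[1] * a 1%N + P1.[0] = 0 ->
  (forall n, P0.[n.+2%:R] * a n.+2 + P1.[n.+1%:R] * a n.+1 + P2.[n%:R] * a n = 0) ->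
  is_coef_seq [:: P0; P1; P2] a.
Proof.
move=> P00 P0N0 a0 a1 a2; split.
  split=> // n; have [d0 d1 d2] := diffop_order2E P0 P1 P2 a.
  by case: n => [|[|n]]; rewrite ?d0 ?P00 ?mul0r // ?d1 ?d2 // a0 mulr1.
move=> b [b0 Lb]; have [_ d1 d2] := diffop_order2E P0 P1 P2 b.
have ab1 : a 1%N = b 1%N.
  apply: (mulfI (P0N0 0%N)); apply: (addIr P1.[0]).
  by have := Lb 1%N; rewrite d1 b0 mulr1 a1 => ->.
suff ab n : a n = b n /\ a n.+1 = b n.+1 by apply: funext => n; case: (ab n).
elim: n => [|n [IH0 IH1]]; first by rewrite a0 b0.
split=> //; apply: (mulfI (P0N0 n.+1)).
apply: (addIr (P1.[n.+1%:R] * a n.+1 + P2.[n%:R] * a n)).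
by rewrite addrA a2 IH0 IH1 addrA -d2.
Qed.

Lemma diag_coef0 p : diag_coef p 0 = 1.
Proof. by rewrite /diag_coef expr0 !coef1. Qed.

Lemma diag_coef1_Pxy M : diag_coef (Pxy M) 1 = (bentry M 1 1)%:~R.
Proof. by rewrite /diag_coef expr1 coef_Pxy. Qed.

(** The functions [e0], [e1], [e2] are the integer values of the operator coefficients, so the
    identity to be checked contains no fractions. Telescoping starts at the third term; the second
    one, the central entry of [M], is checked separately. *)
Lemma is_coef_seq_diag (P0 P1 P2 : {poly rat}) (d : int) (e0 e1 e2 : nat -> int)
    (M : seq (seq int)) (A B : nat -> seq (seq int)) :
  Pxy M != 0 -> d != 0 ->
  P0.[0] = 0 -> (forall n : nat, P0.[n.+1%:R] != 0) ->
  P0.[1] * (bentry M 1 1)%:~R + P1.[0] = 0 ->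
  (forall n, [/\ P0.[n.+2%:R] = (e0 n)%:~R,
     P1.[n.+1%:R] = (e1 n)%:~R & P2.[n%:R] = (e2 n)%:~R]) ->
  (forall n,
    d%:~R * ((e0 n)%:~R * Pxy M ^+ 2 + (e1 n)%:~R * XY * Pxy M
             + (e2 n)%:~R * XY ^+ 2) * Pxy M =
    (Pxy (scale_rows (A n)) - n.+2%:R * Pxy (A n)) * Pxy M
      + n%:R * Pxy (A n) * Pxy (scale_rows M)
    + ((Pxy (scale_cols (B n)) - n.+2%:R * Pxy (B n)) * Pxy M
      + n%:R * Pxy (B n) * Pxy (scale_cols M))) ->
  is_coef_seq [:: P0; P1; P2] (diag_coef (Pxy M)).
Proof.
move=> M0 d0 P00 P0N0 a1 He Hc; apply: is_coef_seq_order2 => //.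
- exact: diag_coef0.
- by rewrite diag_coef1_Pxy.
move=> n; have [-> -> ->] := He n.
apply: (diag_coef_telescope _ (Pxy (A n)) (Pxy (B n)) _ _ _ _ _ M0 d0).
by rewrite !eulerx_Pxy !eulery_Pxy Hc.
Qed.

(** * Supports and Newton polygons *)

Lemma tofrac_Pxy M : FracField.tofrac (Pxy M) = bipoly x y M.
Proof. exact: rmorph_bipoly. Qed.

Lemma coef_mulXYn (p : bp) (k i j : nat) :
  (p * XY ^+ k)`_i`_j =
    if (k <= i)%N && (k <= j)%N then p`_(i - k)`_(j - k) else 0.
Proof.
rewrite exprMn mulrA mulrAC coefMXn ltnNge; case: leqP => //= _; last first.
  by rewrite coef0.
by rewrite -polyC_exp coefMC coefMXn ltnNge; case: leqP.
Qed.

Lemma laurent_coef_support M (m : 'rV[int]_2) :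
  laurent_coef (bipoly x y M / (x * y)) m != 0 ->
  exists i j, [/\ bentry M i j != 0, m 0 0 = i%:Z - 1 & m 0 1 = j%:Z - 1].
Proof.
(* Exponents of [m] may lie far below -1. Enlarging the denominator to the power K + 1 makes both
   shifted exponents natural numbers. *)
set K := addn (absz (m 0 0)) (absz (m 0 1)).
have xyE : x * y = FracField.tofrac (XY : bp) by rewrite rmorphM.
have xyN0 : x * y != 0.
  by rewrite xyE tofrac_eq0 mulf_neq0 ?polyX_eq0 ?polyC_eq0 ?polyX_eq0.
have -> : bipoly x y M / (x * y) =
    FracField.tofrac (Pxy M * XY ^+ K) / (x * y) ^+ K.+1.
  have -> : FracField.tofrac (Pxy M * XY ^+ K) = bipoly x y M * (x * y) ^+ K.
    by rewrite xyE -tofrac_Pxy rmorphM rmorphXn.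
  apply: (mulIf (expf_neq0 K.+1 xyN0)).
  by rewrite mulfVK ?expf_neq0 // exprS mulrA mulfVK.
rewrite (@laurent_coefE _ _ (absz (m 0 0 + K.+1%:Z)) (absz (m 0 1 + K.+1%:Z)));
  [|lia..].
rewrite coef_mulXYn coef_Pxy; case: ifP => [/andP[Ki Kj]|]; last by rewrite eqxx.
by rewrite intr_eq0 => M0; eexists _, _; split; [exact: M0 | lia..].
Qed.

Lemma laurent_coef_bipoly M (m : 'rV[int]_2) (i j : nat) :
  m 0 0 = i%:Z - 1 -> m 0 1 = j%:Z - 1 ->
  laurent_coef (bipoly x y M / (x * y)) m = (bentry M i j)%:~R.
Proof.
by rewrite -tofrac_Pxy -[x * y]expr1 -coef_Pxy => m0 m1; apply: laurent_coefE.
Qed.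

Lemma newton_polygon_monomial (R : realType) f m :
  laurent_coef f m != 0 -> newton_polygon R f (map_mx intr m).
Proof.
move=> fm; exists [:: m], (fun=> 1); split; rewrite ?big_seq1 ?scale1r //.
by move=> m'; rewrite inE => /eqP ->.
Qed.

(** A strip of the form |v_k| <= c is convex, so it contains the hull as soon as it contains the
    support. *)
Lemma newton_polygon_bound (R : realType) f (c : int) (k : 'I_2) v :
  (forall m, laurent_coef f m != 0 -> `|m 0 k| <= c) ->
  newton_polygon R f v -> `|v 0 k| <= c%:~R.
Proof.
move=> fc [s [w [sf w0 w1 ->]]]; rewrite summxE.
have -> : c%:~R = \sum_(m <- s) w m * c%:~R by rewrite -mulr_suml w1 mul1r.
rewrite big_seq [leRHS]big_seq.
apply: le_trans (ler_norm_sum _ _ _) _; apply: ler_sum => m ms.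
rewrite !mxE normrM (ger0_norm (w0 m ms)) ler_wpM2l ?w0 //.
by rewrite -intr_norm ler_int fc ?sf.
Qed.

(* An affine unimodular map sends an edge of lattice length 3 to a segment
   u + 3 [0, 1] w with w a nonzero lattice vector. *)
Lemma newton_equivalentPn (R : realType) f g (m : 'rV[int]_2) :
  laurent_coef f m != 0 -> laurent_coef f (m + 3 *: delta_mx 0 0) != 0 ->
  (forall n k, laurent_coef g n != 0 -> `|n 0 k| <= 1) ->
  ~ newton_equivalent R f g.
Proof.
move=> fm fm3 gb [A [b [Au fg]]].
have im n : laurent_coef f n != 0 ->
    newton_polygon R g (map_mx intr (n *m A + b)).
  by move=> fn; rewrite -fg; exists (map_mx intr n);
    [exact: newton_polygon_monomial | rewrite map_mxD map_mxM].
have bnd n k : laurent_coef f n != 0 -> `|(n *m A + b) 0 k| <= 1.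
  move=> /im/(newton_polygon_bound _ _ 1 k) => /(_ (fun n => gb n k)).
  by rewrite mxE -intr_norm ler_int.
(* Both image points have coordinates in [-1, 1] and differ by three times this integer vector; a
   multiple of 3 of absolute value at most 2 is 0. *)
have A0 : delta_mx 0 0 *m A = 0 :> 'rV_2.
  apply/rowP => k; have := bnd _ k fm; have := bnd _ k fm3.
  by rewrite mulmxDl -scalemxAl !mxE; lia.
have /rowP/(_ 0) : (delta_mx 0 0 : 'rV[int]_2) = 0.
  by rewrite -(mulmxK Au (delta_mx 0 0)) A0 mul0mx.
by rewrite !mxE.
Qed.

(** * Explicit certificates and their verification *)

(** This exchanges x and y. Rows may have different lengths: [k] bounds them, and missing entries
    count as 0. *)
Definition transpose (k : nat) (M : seq (seq int)) : seq (seq int) :=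
  mkseq (fun j => [seq nth 0 r j | r <- M]) k.

Lemma Pxy_neq0 i j M : bentry M i j != 0 -> Pxy M != 0.
Proof.
apply: contra_neq => M0; apply/eqP; rewrite -(intr_eq0 rat) -coef_Pxy M0.
by rewrite !coef0.
Qed.

Lemma constant_term_bipoly M n :
  constant_term ((bipoly x y M / (x * y)) ^+ n) = diag_coef (Pxy M) n.
Proof. by rewrite -tofrac_Pxy constant_term_pow. Qed.

(* [hornerE] would unfold numerals such as 27 into sums of ones. *)
Ltac eval_horner :=
  rewrite -?polyC_natr ?(hornerD, hornerN, horner_exp, hornerM, hornerX, hornerC).

(** The cases follow the hypotheses of [is_coef_seq_diag]. All six numerators have a nonzero entry
    (1, 2). In the last case the variables are replaced by arbitrary ring elements, which [ring]
    treats as atoms. *)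
Ltac check_certificate :=
  [> exact: (@Pxy_neq0 1 2) | by [] | by eval_horner; rewrite expr0n ?mulr0
   | by move=> n; eval_horner; rewrite ?mulf_neq0 ?expf_neq0 ?pnatr_eq0
   | by rewrite /bentry /=; eval_horner; ring
   | by move=> n; eval_horner; split; field
   | move=> n; cbv [Pxy bipoly]; simpl; move: 'X ('X%:P) => u v; ring].

Definition num_T3 : seq (seq int) :=
  [:: [:: 2; 3; -3; -2];
      [:: 3; 12; 3];
      [:: -3; 3];
      [:: -2]].

Definition certx_T3 (n : nat) : seq (seq int) :=
  let m := n%:Z in
  [:: [:: -8 - 4 * m; -42 - 24 * m; 12 + 12 * m; 104 + 64 * m; 6 * m; -30 - 18 * m];
      [:: -12 - 6 * m; -78 - 36 * m; 30 + 51 * m; 54 + 9 * m; 0; -30 - 18 * m];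
      [:: 12 + 6 * m; 84 + 60 * m; 0; 54 + 9 * m; - 6 * m];
      [:: 0; 84 + 60 * m; -30 - 51 * m; 104 + 64 * m];
      [:: -12 - 6 * m; -78 - 36 * m; -12 - 12 * m];
      [:: 12 + 6 * m; -42 - 24 * m];
      [:: 8 + 4 * m]].

Definition certy_T3 (n : nat) := transpose 7 (certx_T3 n).

Lemma is_coef_seq_T3 : is_coef_seq T3 (diag_coef (Pxy num_T3)).
Proof.
apply: (is_coef_seq_diag _ _ _ 1
  (fun n => 2 * n.+2%:Z ^+ 2)
  (fun n => - (3 * (27 * n.+1%:Z ^+ 2 + 27 * n.+1%:Z + 8)))
  (* Here 81 = 3^6 / 9, as each linear factor absorbs a denominator 3. The other operators are
     rescaled in the same way. *)
  (fun n => 81 * (3 * n%:Z + 2) * (3 * n%:Z + 4))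
  num_T3 certx_T3 certy_T3).
all: check_certificate.
Qed.

Definition num_T2 : seq (seq int) :=
  [:: [:: 1];
      [:: 2; 0; 3];
      [:: 1; 0; 3]].

(** [num_T2] is not symmetric, so both certificates are listed. Like the numerator, they contain
    only even powers of y. *)
Definition certx_T2 (n : nat) : seq (seq int) :=
  let m := n%:Z in
  [:: [::];
      [:: 0; 0; -24 - 24 * m];
      [:: 0; 0; 36 + 18 * m];
      [:: 0; 0; 72 + 54 * m];
      [:: 0; 0; 12 + 12 * m]].

Definition certy_T2 (n : nat) : seq (seq int) :=
  let m := n%:Z in
  [:: [:: -2 - m];
      [:: -8 - 4 * m; 0; 12 + 12 * m];
      [:: -12 - 6 * m; 0; -30 - 21 * m; 0; 18 + 9 * m];
      [:: -8 - 4 * m; 0; -6 - 6 * m; 0; 36 + 18 * m];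
      [:: -2 - m; 0; 0; 0; 18 + 9 * m]].

Lemma is_coef_seq_T2 : is_coef_seq T2 (diag_coef (Pxy num_T2)).
Proof.
apply: (is_coef_seq_diag _ _ _ 1
  (fun n => n.+2%:Z ^+ 2)
  (fun=> 0)
  (fun n => - (9 * (3 * n%:Z + 2) * (3 * n%:Z + 4)))
  num_T2 certx_T2 certy_T2).
all: check_certificate.
Qed.

Definition num_O4 : seq (seq int) :=
  [:: [:: 1; 2; -3];
      [:: 2; 12; 2];
      [:: -3; 2; 1]].

Definition certx_O4 (n : nat) : seq (seq int) :=
  let m := n%:Z in
  [:: [:: -6 - 3 * m; -48 - 30 * m; 24 + 39 * m; 90 + 54 * m];
      [:: 0; -124 - 68 * m; 80 + 184 * m; -108 - 60 * m];
      [:: 6 + 3 * m; 160 + 98 * m; - 66 * m; -100 - 74 * m; -18 - 9 * m];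
      [:: -108 - 54 * m; -84 + 72 * m; -80 - 136 * m; 124 + 56 * m; 12 + 6 * m];
      [:: 108 + 54 * m; -144 - 72 * m; -24 - 21 * m; 42 + 24 * m; 6 + 3 * m]].

Definition certy_O4 (n : nat) := transpose 5 (certx_O4 n).

Lemma is_coef_seq_O4 : is_coef_seq O4 (diag_coef (Pxy num_O4)).
Proof.
(* The multiplier 2 makes up for the scaling of the certificate to integer entries: half of [39 * m]
   would not be integral. *)
apply: (is_coef_seq_diag _ _ _ 2
  (fun n => 3 * n.+2%:Z ^+ 2)
  (fun n => - (4 * (28 * n.+1%:Z ^+ 2 + 28 * n.+1%:Z + 9)))
  (fun n => 64 * (4 * n%:Z + 3) * (4 * n%:Z + 5))
  num_O4 certx_O4 certy_O4).
all: check_certificate.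
Qed.

Definition num_O3a : seq (seq int) :=
  [:: [:: 1; -2; -1; 2];
      [:: -2; 6; -2];
      [:: -1; -2];
      [:: 2]].

Definition certx_O3a (n : nat) : seq (seq int) :=
  let m := n%:Z in
  [:: [:: -2 - m; 16 + 10 * m; -8 - 4 * m; -32 - 20 * m; 10 + 5 * m; 16 + 10 * m];
      [:: 0; -34 - 22 * m; 8; 78 + 46 * m; 0; -56 - 36 * m];
      [:: 12 + 6 * m; -36 - 20 * m; 24 + 4 * m; -76 - 20 * m; 40 + 28 * m];
      [:: 0; 74 + 50 * m; -8; 64 + 32 * m];
      [:: -18 - 9 * m; 20 + 10 * m; -16];
      [:: 0; -40 - 28 * m];
      [:: 8 + 4 * m]].

Definition certy_O3a (n : nat) := transpose 7 (certx_O3a n).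

Lemma is_coef_seq_O3a : is_coef_seq O3 (diag_coef (Pxy num_O3a)).
Proof.
apply: (is_coef_seq_diag _ _ _ 2
  (fun n => n.+2%:Z ^+ 2)
  (fun n => - (2 * (10 * n.+1%:Z ^+ 2 + 10 * n.+1%:Z + 3)))
  (fun n => 4 * (4 * n%:Z + 3) * (4 * n%:Z + 5))
  num_O3a certx_O3a certy_O3a).
all: check_certificate.
Qed.

Definition num_O3b : seq (seq int) :=
  [:: [:: 0; 2; 2];
      [:: 1; 6; 1];
      [:: 2; 2]].

Definition certx_O3b (n : nat) : seq (seq int) :=
  let m := n%:Z in
  [:: [:: 0; 0; -8 - 4 * m; -16 - 8 * m; -8 - 4 * m];
      [:: 0; -14 - 6 * m; -20 - 2 * m; -6 - 2 * m; 8 + 4 * m];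
      [:: -6 - 3 * m; -33 - 13 * m; 0; 33 + 13 * m; 6 + 3 * m];
      [:: -8 - 4 * m; 6 + 2 * m; 20 + 2 * m; 14 + 6 * m];
      [:: 8 + 4 * m; 16 + 8 * m; 8 + 4 * m]].

Definition certy_O3b (n : nat) : seq (seq int) :=
  let m := n%:Z in
  [:: [::];
      [:: 0; -2; 0; 14 + 10 * m; 12 + 10 * m];
      [:: -2 - m; -34 - 26 * m; 0; 34 + 26 * m; 2 + m];
      [:: -12 - 10 * m; -14 - 10 * m; 0; 2]].

Lemma is_coef_seq_O3b : is_coef_seq O3 (diag_coef (Pxy num_O3b)).
Proof.
apply: (is_coef_seq_diag _ _ _ 1
  (fun n => n.+2%:Z ^+ 2)
  (fun n => - (2 * (10 * n.+1%:Z ^+ 2 + 10 * n.+1%:Z + 3)))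
  (fun n => 4 * (4 * n%:Z + 3) * (4 * n%:Z + 5))
  num_O3b certx_O3b certy_O3b).
all: check_certificate.
Qed.

Definition num_I5 : seq (seq int) :=
  [:: [:: 2; 1];
      [:: -3; 10; -1];
      [:: -2; 3; 2]].

Definition certx_I5 (n : nat) : seq (seq int) :=
  let m := n%:Z in
  [:: [:: 0; -16 - 12 * m; -4 - 2 * m];
      [:: 40 + 20 * m; 82 + 22 * m; 10 + 15 * m; 12 + 4 * m];
      [:: -76 - 38 * m; 76 + 30 * m; -6; 60 - 14 * m; -12 - 6 * m];
      [:: -16 - 8 * m; -112 - 40 * m; 2 - 45 * m; 24; 16 + 8 * m];
      [:: 16 + 8 * m; -48 - 24 * m; 4 + 2 * m; 48 + 24 * m; 16 + 8 * m]].

Definition certy_I5 (n : nat) : seq (seq int) :=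
  let m := n%:Z in
  [:: [:: -16 - 8 * m; 0; 4 + 2 * m];
      [:: 28 + 4 * m; -78 + 2 * m; 0; -4];
      [:: -4 + 6 * m; 2 - 29 * m; 6 + 22 * m; 10 + 23 * m; 4 + 2 * m];
      [:: -56 - 44 * m; 76 + 82 * m; 92 + 40 * m; -28 - 46 * m; -24 - 20 * m]].

Lemma is_coef_seq_I5 : is_coef_seq I5 (diag_coef (Pxy num_I5)).
Proof.
apply: (is_coef_seq_diag _ _ _ 1
  (fun n => 2 * n.+2%:Z ^+ 2)
  (fun n => - (59 * n.+1%:Z ^+ 2 + 59 * n.+1%:Z + 20))
  (fun n => 12 * (6 * n%:Z + 5) * (6 * n%:Z + 7))
  num_I5 certx_I5 certy_I5).
all: check_certificate.
Qed.

(** * Non-equivalence for [O3], and the five representations *)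

Lemma num_O3_not_newton_equivalent (R : realType) :
  ~ newton_equivalent R (bipoly x y num_O3a / (x * y))
      (bipoly x y num_O3b / (x * y)).
Proof.
(* The edge joins the exponents of 1/(xy) and x^2/y, which are the entries (0, 0) and (3, 0) of
   [num_O3a]. *)
apply: (newton_equivalentPn _ _ _ (const_mx (-1))).
- by rewrite (@laurent_coef_bipoly _ _ 0 0) ?mxE.
- by rewrite (@laurent_coef_bipoly _ _ 3 0) ?mxE.
- move=> n k /laurent_coef_support [i [j [M0 n0 n1]]].
  have [i2 j2] : (i < 3 /\ j < 3)%N.
    (* Entries outside the 3 by 3 block are 0 by default; division by xy then shifts the indices 0,
       1, 2 to -1, 0, 1. *)
    by case: i {n0} M0 => [|[|[|i]]]; case: j {n1} => [|[|[|j]]];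
       rewrite /bentry /= ?nth_nil.
  case: k => [[|[|//]] k2].
    by rewrite (_ : Ordinal k2 = 0) ?n0; [lia | apply: val_inj].
  by rewrite (_ : Ordinal k2 = 1) ?n1; [lia | apply: val_inj].
Qed.

Theorem mainTheorem6 :
  (exists a : nat -> rat, is_coef_seq T3 a /\
    let F : ratfun :=
      (y + 2 + x) * (y - 2 * x - 1) * (x - 2 * y - 1) / (x * y) in
    forall n : nat, a n = constant_term (F ^+ n))
  /\
  (exists a : nat -> rat, is_coef_seq T2 a /\
    let F : ratfun :=
      (3 * x ^+ 2 * y ^+ 2 + x ^+ 2 + 3 * x * y ^+ 2 + 2 * x + 1) / (x * y) in
    forall n : nat, a n = constant_term (F ^+ n))
  /\
  (exists a : nat -> rat, is_coef_seq O4 a /\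
    let F : ratfun :=
      (x ^+ 2 * y ^+ 2 + 2 * x ^+ 2 * y - 3 * x ^+ 2 + 2 * x * y ^+ 2
         + 12 * x * y + 2 * x - 3 * y ^+ 2 + 2 * y + 1) / (x * y) in
    forall n : nat, a n = constant_term (F ^+ n))
  /\
  (exists a : nat -> rat, is_coef_seq O3 a /\
    let F1 : ratfun :=
      (x + y - 1)
        * (2 * x ^+ 2 - 4 * x * y + x + 2 * y ^+ 2 + y - 1) / (x * y) in
    let F2 : ratfun := (y + 2 * x + 1) * (x * y + x + 2 * y) / (x * y) in
    [/\ forall n : nat, a n = constant_term (F1 ^+ n),
        forall n : nat, a n = constant_term (F2 ^+ n) &
        forall R : realType, ~ newton_equivalent R F1 F2])
  /\
  (exists a : nat -> rat, is_coef_seq I5 a /\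
    let F : ratfun :=
      (2 * x ^+ 2 * y ^+ 2 + 3 * x ^+ 2 * y - 2 * x ^+ 2 - x * y ^+ 2
         + 10 * x * y - 3 * x + y + 2) / (x * y) in
    forall n : nat, a n = constant_term (F ^+ n)).
Proof.
have diag L M F : is_coef_seq L (diag_coef (Pxy M)) -> F = bipoly x y M / (x * y) ->
    exists a : nat -> rat,
      is_coef_seq L a /\ forall n, a n = constant_term (F ^+ n).
  move=> LM ->; exists (diag_coef (Pxy M)); split=> // n.
  by rewrite constant_term_bipoly.
split; first by apply: (diag _ _ _ is_coef_seq_T3); congr (_ / _); simpl; ring.
split; first by apply: (diag _ _ _ is_coef_seq_T2); congr (_ / _); simpl; ring.
split; first by apply: (diag _ _ _ is_coef_seq_O4); congr (_ / _); simpl; ring.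
split; last by apply: (diag _ _ _ is_coef_seq_I5); congr (_ / _); simpl; ring.
exists (diag_coef (Pxy num_O3a)); split; first exact: is_coef_seq_O3a.
move=> F1 F2.
have -> : F1 = bipoly x y num_O3a / (x * y) by congr (_ / _); simpl; ring.
have -> : F2 = bipoly x y num_O3b / (x * y) by congr (_ / _); simpl; ring.
split=> [n|n|R]; rewrite ?constant_term_bipoly //.
  (* Both diagonal sequences solve [O3] with first term 1, so uniqueness identifies them. *)
  have [_ uniq_a] := is_coef_seq_O3a; have [b_sol _] := is_coef_seq_O3b.
  by rewrite (uniq_a _ b_sol).
exact: num_O3_not_newton_equivalent.
Qed.
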